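(* Let $\mathbb{H}=\mathbb{R}$ or $\mathbb{C}$, let $x,x_0\in\mathbb{H}^d$, and let $\{W_n\}_{n=1}^\infty$ be independent and identically distributed versions of a random subspace $W$ of $\mathbb{H}^d$ which has logarithmic Kaczmarz bound $0\le\alpha_{\log}\le 1$. Define the iterates $x_n=x_{n-1}+P_{W_n}(x)-P_{W_n}(x_{n-1})$ for $n\ge1$. Then $$\exp\left(\mathbb{E}\left[\log\|x-x_n\|^2\right]\right)\le \alpha_{\log}^n\,\|x-x_0\|^2 .$$
   Context: $\mathbb{H}^d$ is $\mathbb{R}^d$ or $\mathbb{C}^d$ with the standard inner product; $\mathbb{S}^{d-1}=\{u\in\mathbb{H}^d:\|u\|=1\}$; $P_W$ denotes the orthogonal projection onto a subspace $W$. A random subspace is a random variable taking values in the set of all linear subspaces of $\mathbb{H}^d$ (dimensions need not be fixed). The logarithmic Kaczmarz bound of a random subspace $W$ is $\alpha_{\log}=\sup_{u\in\mathbb{S}^{d-1}}\exp\left(\mathbb{E}\left[\log(1-\|P_W(u)\|^2)\right]\right)\in[0,1]$ (with $\log 0=-\infty$, $\exp(-\infty)=0$). *)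

(* Defs.v *)
From HB Require Import structures.
From mathcomp Require Import all_boot all_order all_algebra.
From mathcomp Require Import all_classical all_reals all_analysis.
From mathcomp Require Import complex.

Unset Implicit Arguments.
Unset Strict Implicit.
Unset Printing Implicit Defensive.

Import Order.TTheory GRing.Theory Num.Theory.
Local Open Scope classical_set_scope.
Local Open Scope ring_scope.

(* H^d is modelled as row vectors 'rV[K]_d, where the scalar field K (R or R[i])
   comes with its conjugation [conj] and real part [re] (identity for K = R). *)
Section Hilbert.
Variables (R : realType) (K : fieldType) (conj : K -> K) (re : K -> R) (d : nat).

Definition hdot (u v : 'rV[K]_d) : K := \sum_(i < d) u 0 i * conj (v 0 i).

Definition hnorm2 (u : 'rV[K]_d) : R := re (hdot u u).

Definition oproj (W : {vspace 'rV[K]_d}) (x : 'rV[K]_d) : 'rV[K]_d :=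
  xget 0 (fun p => p \in W /\ forall w, w \in W -> hdot (x - p) w = 0).

Definition subspace_events : set (set {vspace 'rV[K]_d}) :=
  <<s setT, [set (fun W => hnorm2 (oproj W u)) @^-1` B
             | B in [set B : set R | measurable B] & u in [set: 'rV[K]_d]] >>.

Definition elog (t : R) : \bar R := if t == 0 then -oo%E else (ln t)%:E.

Section Random.
Context {dT : measure_display} {T : measurableType dT}.

Definition random_subspace (W : T -> {vspace 'rV[K]_d}) : Prop :=
  forall A, subspace_events A -> measurable (W @^-1` A).

Definition mutually_independent (P : probability T R)
    (Wn : nat -> T -> {vspace 'rV[K]_d}) : Prop :=
  forall (S : seq nat) (A : nat -> set {vspace 'rV[K]_d}),
    uniq S -> (forall i, subspace_events (A i)) ->
    P (\bigcap_(i in [set i | i \in S]) (Wn i @^-1` A i)) =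
    (\prod_(i <- S) P (Wn i @^-1` A i))%E.

Definition alpha_log (P : probability T R) (W : T -> {vspace 'rV[K]_d}) : \bar R :=
  ereal_sup [set expeR (\int[P]_w elog (1 - hnorm2 (oproj (W w) u)))
            | u in [set u : 'rV[K]_d | hnorm2 u = 1]].

(* iterates: x_0 given, x_{n+1} = x_n + P_{W_{n+1}} x - P_{W_{n+1}} x_n,
   where W_{n+1} is [Wn n] (0-based indexing of the sequence) *)
Fixpoint kaczmarz (Wn : nat -> T -> {vspace 'rV[K]_d}) (x x0 : 'rV[K]_d)
    (n : nat) (w : T) : 'rV[K]_d :=
  match n with
  | 0 => x0
  | m.+1 => let y := kaczmarz Wn x x0 m w in
            y + oproj (Wn m w) x - oproj (Wn m w) y
  end.

End Random.
End Hilbert.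

Arguments elog {R} t.
Arguments hnorm2 {R K} conj re {d} u.
Arguments oproj {K} conj {d} W x.
Arguments subspace_events {R K} conj re d _.
Arguments random_subspace {R K} conj re {d dT T} W.
Arguments mutually_independent {R K} conj re {d dT T} P Wn.
Arguments alpha_log {R K} conj re {d dT T} P W.
Arguments kaczmarz {K} conj {d dT T} Wn x x0 n w.
Definition thm34_statement (R : realType) (K : fieldType) (conj : K -> K) (re : K -> R) : Prop :=
  forall (d : nat)
    (dT : measure_display) (T : measurableType dT) (P : probability T R)
    (dT' : measure_display) (T' : measurableType dT') (P' : probability T' R)
    (W : T' -> {vspace 'rV[K]_d}) (Wn : nat -> T -> {vspace 'rV[K]_d})
    (x x0 : 'rV[K]_d),
    random_subspace conj re W ->
    (forall n, random_subspace conj re (Wn n)) ->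
    mutually_independent conj re P Wn ->
    (forall n A, subspace_events conj re d A -> P (Wn n @^-1` A) = P' (W @^-1` A)) ->
    forall n : nat,
      (expeR (\int[P]_w elog (hnorm2 conj re (x - kaczmarz conj Wn x x0 n w)))
       <= expe (alpha_log conj re P' W) n * (hnorm2 conj re (x - x0))%:E)%E.
Arguments thm34_statement {R K} conj re.

(* Main.v *)
(* The residuals e_n = x - x_n satisfy e_(n+1) = e_n - P_(W_(n+1)) e_n, so when
   e_n is not zero, |e_(n+1)|^2 = |e_n|^2 (1 - |P_(W_(n+1)) u|^2) with
   u = e_n / |e_n|.  As e_n only depends on W_1, ..., W_n, the subspace W_(n+1)
   is independent of u; by Fubini and the definition of alpha_log, each step
   changes the expected logarithm by at most log alpha_log.  To avoid
   integrability questions everything is phrased with the nonnegative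
   quantities -log (|e_(n+1)|^2 / |e_n|^2) and -log (|e_n|^2 / |e_0|^2).
   Joint measurability of (u, W) |-> |P_W u|^2 holds because this is a
   polynomial in the coordinates of u and in the entries of P_W, and by
   polarization these entries are measurable functions of W. *)

Require Import Defs.
From HB Require Import structures.
From mathcomp Require Import all_boot all_order all_algebra.
From mathcomp Require Import all_classical all_reals all_analysis.
From mathcomp Require Import measurable_realfun ring.

Set Implicit Arguments.
Unset Strict Implicit.
Unset Printing Implicit Defensive.

Import Order.TTheory GRing.Theory Num.Theory.
(* Required last, so that [Re] is the real part on R[i], not the one of [Num]. *)
From mathcomp Require Import complex.
Local Open Scope classical_set_scope.
Local Open Scope ring_scope.

(** * Scalar fields: the properties shared by the reals and the complex numbers *)

Record hilbert_scalars (R : realType) (K : fieldType)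
    (conj : {rmorphism K -> K}) (re : K -> R)
    (inj : {rmorphism R -> K}) (J : K) : Prop := HilbertScalars {
  conjI : involutive conj;
  reD : {morph re : y z / y + z};
  re_conj : forall z, re (conj z) = re z;
  re_injM : forall r z, re (inj r * z) = r * re z;
  conj_inj : forall r, conj (inj r) = inj r;
  mul_conj : forall z, z * conj z = inj (re (z * conj z));
  re_mul_conj_ge0 : forall z, 0 <= re (z * conj z);
  (* [J] is 0 for K = R and the imaginary unit for K = R[i]. *)
  re_decomp : forall z, z = inj (re z) + J * inj (re (- J * z)) }.

Section Scalars.
Variables (R : realType) (K : fieldType) (conj : {rmorphism K -> K}).
Variables (re : K -> R) (inj : {rmorphism R -> K}) (J : K).
Hypothesis HS : hilbert_scalars conj re inj J.

Lemma re0 : re 0 = 0.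
Proof. by have := re_injM HS 0 0; rewrite mulr0 mul0r. Qed.

Lemma reN z : re (- z) = - re z.
Proof. by apply/eqP; rewrite -addr_eq0 -(reD HS) addNr re0. Qed.

Lemma re_sum (I : Type) (s : seq I) (P : pred I) (F : I -> K) :
  re (\sum_(i <- s | P i) F i) = \sum_(i <- s | P i) re (F i).
Proof. by apply: (big_morph re (reD HS) re0). Qed.

Lemma re_mul_conj_eq0 z : re (z * conj z) = 0 -> z = 0.
Proof.
move=> z0; have /eqP := mul_conj HS z; rewrite z0 rmorph0 mulf_eq0.
by case/orP => /eqP // cz; rewrite -(conjI HS z) cz rmorph0.
Qed.

(** * Inner product and orthogonal projections *)

Section Vectors.
Variable d : nat.
Implicit Types (u v w x y : 'rV[K]_d) (W : {vspace 'rV[K]_d}) (c : K).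

Local Notation dot := (hdot K conj d).
Local Notation norm2 := (hnorm2 conj re).
Local Notation proj := (oproj conj).

Lemma hdotDl u v w : dot (u + v) w = dot u w + dot v w.
Proof. by rewrite -big_split; apply: eq_bigr => i _; rewrite mxE mulrDl. Qed.

Lemma hdotZl c u v : dot (c *: u) v = c * dot u v.
Proof. by rewrite mulr_sumr; apply: eq_bigr => i _; rewrite mxE mulrA. Qed.

Lemma hdotC u v : dot v u = conj (dot u v).
Proof.
rewrite /hdot rmorph_sum; apply: eq_bigr => i _.
by rewrite rmorphM (conjI HS) mulrC.
Qed.

Lemma hdotDr u v w : dot u (v + w) = dot u v + dot u w.
Proof. by rewrite hdotC hdotDl rmorphD -!hdotC. Qed.

Lemma hdotZr c u v : dot u (c *: v) = conj c * dot u v.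
Proof. by rewrite hdotC hdotZl rmorphM -!hdotC. Qed.

Lemma hdot0l u : dot 0 u = 0.
Proof. by rewrite -[X in dot X](scale0r u) hdotZl mul0r. Qed.

Lemma hdotNl u v : dot (- u) v = - dot u v.
Proof. by rewrite -scaleN1r hdotZl mulN1r. Qed.

Lemma hdotBl u v w : dot (u - v) w = dot u w - dot v w.
Proof. by rewrite hdotDl hdotNl. Qed.

Lemma hnorm2_ge0 u : 0 <= norm2 u.
Proof.
by rewrite /hnorm2 re_sum; apply: sumr_ge0 => i _; exact: re_mul_conj_ge0 HS _.
Qed.

Lemma hnorm2_eq0 u : norm2 u = 0 -> u = 0.
Proof.
rewrite /hnorm2 re_sum => /eqP; rewrite psumr_eq0; last first.
  by move=> i _; exact: re_mul_conj_ge0 HS _.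
move=> /allP u0; apply/rowP => i; rewrite mxE; apply: re_mul_conj_eq0.
by apply/eqP; apply: u0; rewrite mem_index_enum.
Qed.

Lemma hnorm2D u v : norm2 (u + v) = norm2 u + norm2 v + re (dot u v) *+ 2.
Proof.
rewrite /hnorm2 hdotDl !hdotDr !(reD HS) [dot v u]hdotC (re_conj HS).
by rewrite mulr2n; ring.
Qed.

Lemma hnorm2Z (r : R) u : norm2 (inj r *: u) = r ^+ 2 * norm2 u.
Proof.
by rewrite /hnorm2 hdotZl hdotZr (conj_inj HS) !(re_injM HS) mulrA.
Qed.

(* Gram-Schmidt: the spanning family is extended by one vector [v], which
   contributes along its component orthogonal to the previous span. *)
Lemma span_proj_exists (X : seq 'rV[K]_d) x :
  exists2 p, p \in <<X>>%VS & forall w, w \in <<X>>%VS -> dot (x - p) w = 0.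
Proof.
elim: X x => [|v X IH] x.
  exists 0; first exact: mem0v.
  by move=> w; rewrite span_nil memv0 => /eqP ->; rewrite hdotC hdot0l rmorph0.
have [q qX vq] := IH v; have [p pX xp] := IH x.
pose v' := v - q; pose c := dot x v' / dot v' v'.
have v'X s : s \in <<X>>%VS -> dot v' s = 0 by exact: vq.
have sub1 : v \in <<v :: X>>%VS.
  by rewrite span_cons; apply: (subvP (addvSl _ _)); exact: memv_line.
have sub2 s : s \in <<X>>%VS -> s \in <<v :: X>>%VS.
  by rewrite span_cons; apply: (subvP (addvSr _ _)).
exists (p + c *: v').
  by apply: memvD; [exact: sub2|apply/memvZ/memvB => //; exact: sub2].
move=> w; rewrite span_cons => /memv_addP[_ /vlineP[a ->]] [s sX ->].
(* Trading [v] for [v'] writes [w] as a multiple of [v'] plus a vector of the old span, so two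
   orthogonality relations suffice. *)
have -> : a *: v + s = a *: v' + (a *: q + s).
  by rewrite scalerBr addrA subrK.
have qsX : a *: q + s \in <<X>>%VS by rewrite memvD ?memvZ.
have px : dot p v' = 0 by rewrite hdotC v'X// rmorph0.
rewrite opprD addrA hdotDr [X in _ + X]hdotBl xp// hdotZl v'X// mulr0 subr0.
rewrite addr0.
rewrite hdotZr !hdotBl hdotZl px subr0.
(* If [v] already lies in the old span, then [v'] is 0 and orthogonality to [v'] is trivial;
   otherwise [c] can be divided out. *)
have [v'0|v'0] := eqVneq (dot v' v') 0.
  rewrite v'0 mulr0 subr0.
  have -> : v' = 0.
    by apply: hnorm2_eq0; rewrite /hnorm2 v'0 re0.
  by rewrite hdotC hdot0l rmorph0 mulr0.
by rewrite /c divfK// subrr mulr0.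
Qed.

(** Gram-Schmidt on a basis of [W] provides a projection, so the choice operator in [oproj] does not
    fall back on its default 0. *)
Lemma oprojP W x :
  proj W x \in W /\ forall w, w \in W -> dot (x - proj W x) w = 0.
Proof.
have [p pW pP] := span_proj_exists (vbasis W) x.
rewrite /oproj; case: xgetP => [q -> //|/(_ p)[]].
by rewrite (span_basis (vbasisP W)) in pW pP.
Qed.

Lemma oproj_in W x : proj W x \in W.
Proof. by case: (oprojP W x). Qed.

Lemma oproj_orth W x w : w \in W -> dot (x - proj W x) w = 0.
Proof. by case: (oprojP W x) => _; apply. Qed.

(** The difference of two candidates lies in [W] and is orthogonal to [W], hence to itself.
    Linearity of the projection follows from this. *)
Lemma oproj_unique W x p :
  p \in W -> (forall w, w \in W -> dot (x - p) w = 0) -> proj W x = p.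
Proof.
move=> pW xp; apply/eqP; rewrite -subr_eq0; apply/eqP/hnorm2_eq0.
have dW : proj W x - p \in W by rewrite memvB// oproj_in.
have E : proj W x - p = (x - p) - (x - proj W x) 
  by rewrite opprB [RHS]addrC addrA subrK.
by rewrite /hnorm2 {1}E hdotBl xp// oproj_orth// subr0 re0.
Qed.

Lemma oprojD W x y : proj W (x + y) = proj W x + proj W y.
Proof.
apply: oproj_unique => [|w wW]; first by rewrite memvD ?oproj_in.
by rewrite opprD addrACA hdotDl !oproj_orth// addr0.
Qed.

Lemma oprojZ W c x : proj W (c *: x) = c *: proj W x.
Proof.
apply: oproj_unique => [|w wW]; first by rewrite memvZ ?oproj_in.
by rewrite -scalerBr hdotZl oproj_orth// mulr0.
Qed.

Lemma oprojB W x y : proj W (x - y) = proj W x - proj W y.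
Proof. by rewrite -scaleN1r oprojD oprojZ scaleN1r. Qed.

Lemma oproj_sum W (I : Type) (s : seq I) (F : I -> 'rV[K]_d) :
  proj W (\sum_(i <- s) F i) = \sum_(i <- s) proj W (F i).
Proof.
apply: (big_morph (proj W) (oprojD W)).
by rewrite -[X in proj W X](scale0r 0) oprojZ scale0r.
Qed.

Lemma hdot_oproj W x y : dot (proj W x) (proj W y) = dot (proj W x) y.
Proof.
rewrite -[X in _ = dot _ X](subrK (proj W y)) hdotDr [dot _ (_ - _)]hdotC.
by rewrite oproj_orth ?oproj_in// rmorph0 add0r.
Qed.

Lemma pythagoras W x : norm2 (x - proj W x) = norm2 x - norm2 (proj W x).
Proof.
rewrite -[X in norm2 X - _](subrK (proj W x)) (hnorm2D (x - _)).
by rewrite oproj_orth ?oproj_in// re0 mul0rn addr0 addrK.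
Qed.

(** Polarization: entries of the projection matrix are expressed by the squared norms that generate
    the sigma-algebra on subspaces. *)
Lemma re_hdot_oproj W c u v :
  re (c * dot (proj W u) v) =
  (norm2 (proj W (u + conj c *: v)) - norm2 (proj W u)
   - norm2 (proj W (conj c *: v))) / 2.
Proof.
rewrite oprojD hnorm2D hdot_oproj hdotZr (conjI HS).
by rewrite mulr2n; field.
Qed.

End Vectors.
End Scalars.

(** * Measurability of vector-valued maps and of projections *)

Section Measurability.
Variables (R : realType) (K : fieldType) (conj : {rmorphism K -> K}).
Variables (re : K -> R) (inj : {rmorphism R -> K}) (J : K).
Hypothesis HS : hilbert_scalars conj re inj J.
Context {dT : measure_display} {T : measurableType dT}.

(* For K = R this is Borel measurability, for K = R[i] it amounts to Borel
   measurability of the real and imaginary parts. *)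
Definition scalar_measurable (f : T -> K) : Prop :=
  forall c : K, measurable_fun [set: T] (fun t => re (c * f t)).

Lemma scalar_measurable_cst (c : K) : scalar_measurable (fun=> c).
Proof. by move=> a. Qed.

Lemma scalar_measurableD f g : scalar_measurable f -> scalar_measurable g ->
  scalar_measurable (fun t => f t + g t).
Proof.
move=> mf mg c; under eq_fun do rewrite mulrDr (reD HS).
by apply: measurable_funD; [exact: mf|exact: mg].
Qed.

Lemma scalar_measurable_sum (I : Type) (s : seq I) (F : I -> T -> K) :
  (forall i, scalar_measurable (F i)) ->
  scalar_measurable (fun t => \sum_(i <- s) F i t).
Proof.
move=> mF; elim: s => [|i s IH].
  by under eq_fun do rewrite big_nil; exact: scalar_measurable_cst.
by under eq_fun do rewrite big_cons; exact: scalar_measurableD.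
Qed.

Lemma scalar_measurableM f g : scalar_measurable f -> scalar_measurable g ->
  scalar_measurable (fun t => f t * g t).
Proof.
(* Splitting [f t] into real and imaginary parts by [re_decomp] leaves only products of real
   measurable functions. *)
move=> mf mg c.
have E t : re (c * (f t * g t)) =
    re (1 * f t) * re (c * g t) + re (- J * f t) * re (c * J * g t).
  rewrite -!(re_injM HS) -(reD HS) mul1r {1}(re_decomp HS (f t)).
  by congr re; ring.
under eq_fun do rewrite E.
by apply: measurable_funD; apply: measurable_funM; (exact: mf || exact: mg).
Qed.

Lemma scalar_measurable_conj f : scalar_measurable f ->
  scalar_measurable (fun t => conj (f t)).
Proof.
move=> mf c; under eq_fun do rewrite -(re_conj HS) rmorphM (conjI HS).
exact: mf.
Qed.

Lemma scalar_measurableN f : scalar_measurable f ->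
  scalar_measurable (fun t => - f t).
Proof.
move=> mf c; under eq_fun do rewrite mulrN (reN HS).
by apply: measurable_funN; exact: mf.
Qed.

Variable d : nat.

Definition coord_measurable (U : T -> 'rV[K]_d) : Prop :=
  forall j, scalar_measurable (fun t => U t 0 j).

Lemma coord_measurable_cst (u : 'rV[K]_d) : coord_measurable (fun=> u).
Proof. by move=> j; exact: scalar_measurable_cst. Qed.

Lemma coord_measurableB U V : coord_measurable U -> coord_measurable V ->
  coord_measurable (fun t => U t - V t).
Proof.
move=> mU mV j; under eq_fun do rewrite !mxE.
by apply: scalar_measurableD; last apply: scalar_measurableN.
Qed.

Lemma measurable_hnorm2 U : coord_measurable U ->
  measurable_fun [set: T] (fun t => hnorm2 conj re (U t)).
Proof.
move=> mU; rewrite /hnorm2 /hdot; under eq_fun do rewrite -[X in re X]mul1r.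
apply: scalar_measurable_sum => i; apply: scalar_measurableM; first exact: mU.
exact: scalar_measurable_conj.
Qed.

Lemma measurable_hnorm2_oproj (W : T -> {vspace 'rV[K]_d}) (u : 'rV[K]_d) :
  random_subspace conj re W ->
  measurable_fun [set: T] (fun t => hnorm2 conj re (oproj conj (W t) u)).
Proof.
move=> mW _ B mB; rewrite setTI.
rewrite (_ : _ @^-1` B =
  W @^-1` ((fun V => hnorm2 conj re (oproj conj V u)) @^-1` B))//.
apply: mW; apply: sub_sigma_algebra; exists B => //.
by exists u.
Qed.

(** Expanding [U t] in the standard basis separates the two sources of randomness: each coordinate
    is a finite sum of a coordinate of [U t] times a matrix entry of the projection onto [W t]. *)
Lemma coord_measurable_oproj (W : T -> {vspace 'rV[K]_d}) U :
  random_subspace conj re W -> coord_measurable U ->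
  coord_measurable (fun t => oproj conj (W t) (U t)).
Proof.
move=> mW mU j.
have E t : oproj conj (W t) (U t) 0 j =
    \sum_(i < d) U t 0 i *
      hdot K conj d (oproj conj (W t) (delta_mx 0 i)) (delta_mx 0 j).
  rewrite {1}[U t]row_sum_delta (oproj_sum HS) summxE; apply: eq_bigr => i _.
  rewrite (oprojZ HS) mxE; congr (_ * _).
  rewrite /hdot (bigD1 j)//= mxE !eqxx rmorph1 mulr1 big1 ?addr0// => k kj.
  by rewrite mxE eqxx/= (negbTE kj) rmorph0 mulr0.
under eq_fun do rewrite E.
apply: scalar_measurable_sum => i; apply: scalar_measurableM; first exact: mU.
move=> c; under eq_fun do rewrite (re_hdot_oproj HS).
apply: measurable_funM => //.
apply: measurable_funB; [apply: measurable_funB|];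
  exact: measurable_hnorm2_oproj.
Qed.

End Measurability.

(** * Nonnegative logarithmic decrements *)

Section NegLogRatio.
Variable R : realType.
Implicit Types a b c : R.

(* -log (a / b), extended by +oo also at a = b = 0: this keeps
   [neg_log_ratio_trans] valid once the residual has reached 0. *)
Definition neg_log_ratio a b : \bar R :=
  if a * b == 0 then +oo%E else (ln b - ln a)%:E.

Lemma neg_log_ratio0 b : neg_log_ratio 0 b = +oo%E.
Proof. by rewrite /neg_log_ratio mul0r eqxx. Qed.

Lemma neg_log_ratio_fin a b : 0 < a -> 0 < b ->
  neg_log_ratio a b = (ln b - ln a)%:E.
Proof. by move=> a0 b0; rewrite /neg_log_ratio gt_eqF// mulr_gt0. Qed.

Lemma neg_log_ratio_ge0 a b : 0 <= a -> a <= b -> (0 <= neg_log_ratio a b)%E.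
Proof.
rewrite le_eqVlt => /predU1P[<- _|a0 ab]; first by rewrite neg_log_ratio0 leey.
have b0 := lt_le_trans a0 ab.
by rewrite neg_log_ratio_fin// lee_fin subr_ge0 ler_ln ?posrE.
Qed.

(** Logarithms telescope. If [a] is 0, the last summand is [+oo] whatever [b] is, and the other one
    is never [-oo]. *)
Lemma neg_log_ratio_trans a b c : 0 <= a -> a <= b -> 0 < c ->
  neg_log_ratio a c = (neg_log_ratio b c + neg_log_ratio a b)%E.
Proof.
rewrite le_eqVlt => /predU1P[<-|a0].
  rewrite le_eqVlt => /predU1P[<-|b0] c0; rewrite !neg_log_ratio0 ?addye//.
  by rewrite neg_log_ratio_fin.
move=> ab c0; have b0 := lt_le_trans a0 ab.
by rewrite !neg_log_ratio_fin// -EFinD addrA subrK.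
Qed.

Lemma neg_log_ratio_div a b : 0 <= a -> 0 < b ->
  neg_log_ratio a b = neg_log_ratio (a / b) 1.
Proof.
rewrite le_eqVlt => /predU1P[<-|a0] b0; first by rewrite mul0r !neg_log_ratio0.
by rewrite !neg_log_ratio_fin ?divr_gt0// ln_div ?posrE// ln1 sub0r opprB.
Qed.

(** Trades the signed [elog] for a constant minus a decrement; at [t = 0] both sides are [-oo]. *)
Lemma elogE c (t : R) : 0 < c -> elog t = ((ln c)%:E - neg_log_ratio t c)%E.
Proof.
move=> c0; rewrite /elog /neg_log_ratio mulf_eq0 (gt_eqF c0) orbF.
by case: eqP => // _; rewrite -EFinB subKr.
Qed.

Lemma measurable_neg_log_ratio d (T : measurableType d) (f g : T -> R) :
  measurable_fun [set: T] f -> measurable_fun [set: T] g ->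
  measurable_fun [set: T] (fun t => neg_log_ratio (f t) (g t)).
Proof.
move=> mf mg; apply: measurable_fun_ifT => //.
  by apply: measurable_fun_eqr => //; exact: measurable_funM.
by apply/measurable_EFinP/measurable_funB; exact: measurableT_comp.
Qed.

End NegLogRatio.

(** * Integration and independence *)

Section Integration.
Local Open Scope ereal_scope.

(** For integrable [F] this is linearity. Otherwise the right side is [-oo], and so is the left one:
    the positive part of [r - F] is bounded while its negative part has infinite integral. *)
Lemma integral_cstB_le d (T : measurableType d) (R : realType)
    (P : probability T R) (r : R) (F : T -> \bar R) :
  measurable_fun [set: T] F -> (forall t, 0 <= F t) ->
  \int[P]_t (r%:E - F t) <= r%:E - \int[P]_t F t.
Proof.
move=> mF F0.
have PT (c : \bar R) : \int[P]_t c = c.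
  by rewrite integral_cst// [X in _ * X]probability_setT mule1.
have [Foo|] := ltP (\int[P]_t F t) +oo.
  have iF : P.-integrable [set: T] F.
    apply/integrableP; split=> //.
    by under eq_integral do rewrite gee0_abs//.
  have ir : P.-integrable [set: T] (fun=> r%:E).
    apply/integrableP; split=> //.
    by rewrite PT ltry.
  by rewrite integralB// PT.
rewrite leye_eq => /eqP Foo; rewrite Foo /=.
have mg : measurable_fun [set: T] (fun t => r%:E - F t).
  exact: emeasurable_funB.
have gn : \int[P]_t (fun t => r%:E - F t)^\- t = +oo.
  (* The negative part differs from [F] by at most the constant [|r|], which a probability measure
     integrates to a finite number. *)
  have : \int[P]_t F t <= \int[P]_t ((fun t => r%:E - F t)^\- t + `|r|%:E).
    apply: ge0_le_integral => //.
    - by apply: emeasurable_funD => //; exact: measurable_funeneg.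
    - move=> t _; rewrite funenegE; case: (F t) (F0 t) => [s| |]//= _.
      apply: (@le_trans _ _ (- (r - s) + `|r|)%:E).
        by rewrite lee_fin opprB -addrA lerDl addrC subr_ge0 ler_norm.
      by rewrite EFinD leeD2r// le_max; apply/orP; left; exact: lexx.
  rewrite ge0_integralD//; last exact: measurable_funeneg.
  by rewrite Foo PT; case: (\int[P]_t _).
rewrite integralE gn.
have : \int[P]_t (fun t => r%:E - F t)^\+ t <= `|r|%:E.
  rewrite -[leRHS]PT; apply: ge0_le_integral => //.
    exact: measurable_funepos.
  move=> t _; rewrite funeposE ge_max lee_fin normr_ge0 andbT.
  rewrite (@le_trans _ _ r%:E)//; last by rewrite lee_fin ler_norm.
  by rewrite geeDl// oppe_le0.
by case: (\int[P]_t _).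
Qed.

(** Independence on rectangles identifies the law of [(X1, X2)] as the product of the law of [X1]
    with [Q]; Tonelli then applies to the nonnegative [F]. *)
Lemma integral_independent d d1 d2 (T : measurableType d)
    (T1 : measurableType d1) (T2 : measurableType d2) (R : realType)
    (P : probability T R) (Q : probability T2 R) (X1 : T -> T1) (X2 : T -> T2)
    (F : T1 * T2 -> \bar R) :
  measurable_fun [set: T] X1 -> measurable_fun [set: T] X2 ->
  (forall A B, measurable A -> measurable B ->
    P (X1 @^-1` A `&` X2 @^-1` B) = P (X1 @^-1` A) * Q B) ->
  measurable_fun [set: T1 * T2] F -> (forall z, 0 <= F z) ->
  \int[P]_t F (X1 t, X2 t) = \int[P]_t \int[Q]_y F (X1 t, y).
Proof.
move=> mX1 mX2 ind mF F0.
have mX : measurable_fun [set: T] (fun t => (X1 t, X2 t)).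
  exact: measurable_fun_pair.
pose Y1 : {mfun T >-> T1} := mfun_Sub (mem_set mX1).
transitivity (\int[pushforward P (fun t => (X1 t, X2 t))]_z F z).
  by rewrite ge0_integral_pushforward// => z _; exact: F0.
transitivity (\int[(distribution P Y1 \x Q)%E]_z F z).
  apply: eq_measure_integral => A mA _; apply/esym.
  by apply: product_measure_unique => // B C mB mC; exact: ind.
rewrite fubini_tonelli1// ge0_integral_pushforward//.
- exact: measurable_fun_fubini_tonelli_F.
- by move=> x _; exact: integral_ge0.
Qed.

Lemma integral_independent_ge d d1 d2 (T : measurableType d)
    (T1 : measurableType d1) (T2 : measurableType d2) (R : realType)
    (P : probability T R) (Q : probability T2 R) (X1 : T -> T1) (X2 : T -> T2)
    (F : T1 * T2 -> \bar R) (a : \bar R) :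
  measurable_fun [set: T] X1 -> measurable_fun [set: T] X2 ->
  (forall A B, measurable A -> measurable B ->
    P (X1 @^-1` A `&` X2 @^-1` B) = P (X1 @^-1` A) * Q B) ->
  measurable_fun [set: T1 * T2] F -> (forall z, 0 <= F z) ->
  (forall t, a <= \int[Q]_y F (X1 t, y)) ->
  a <= \int[P]_t F (X1 t, X2 t).
Proof.
move=> mX1 mX2 ind mF F0 aF.
(* A negative [a] is below any integral of [F]; for the others, monotonicity of integrals of
   nonnegative functions applies. *)
have [a0|a0] := leP 0 a; last first.
  by apply: le_trans (ltW a0) _; exact: integral_ge0.
rewrite (integral_independent mX1 mX2 ind mF F0).
have -> : a = \int[P]__ a.
  by rewrite integral_cst// [X in _ * X]probability_setT mule1.
apply: ge0_le_integral => //.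
exact: measurableT_comp (measurable_fun_fubini_tonelli_F _ mF F0) mX1.
Qed.

(** Both sides are finite measures in [A], namely a restriction and a multiple of [P]; agreeing on a
    pi-system that contains the whole space, they agree on the sigma-algebra it generates. *)
Lemma independent_pi_system d (T : measurableType d) (R : realType)
    (P : probability T R) (G : set (set T)) (B : set T) :
  G `<=` measurable -> setI_closed G -> G [set: T] -> measurable B ->
  (forall A, G A -> P (A `&` B) = P A * P B) ->
  forall A, <<s G >> A -> P (A `&` B) = P A * P B.
Proof.
move=> mG GI GT mB GB A GA.
pose r : {nonneg R} := NngNum (fine_ge0 (measure_ge0 P B)).
have rE : r%:num%:E = P B by rewrite /= fineK// fin_num_measure.
have -> : P (A `&` B) = mrestr P mB A by [].
have -> : P A * P B = mscale r P A by rewrite /mscale/= rE muleC.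
apply: (@g_sigma_algebra_measure_unique _ _ _ G mG (fun=> setT)) => //.
- by rewrite bigcup_const//; exists 0%N.
- by move=> C GC; transitivity (P C * P B); [exact: GB|rewrite -rE muleC].
- move=> _; change (P ([set: T] `&` B) < +oo).
  by rewrite setTI -ge0_fin_numE ?fin_num_measure.
Qed.

End Integration.

(** * The measurable space of subspaces and the residuals *)

HB.instance Definition _ (K : fieldType) (vT : vectType K) :=
  isPointed.Build {vspace vT} 0%VS.

Section Kaczmarz.
Variables (R : realType) (K : fieldType) (conj : {rmorphism K -> K}).
Variables (re : K -> R) (inj : {rmorphism R -> K}) (J : K).
Hypothesis HS : hilbert_scalars conj re inj J.
Variable d : nat.

(** Naming the generators of [subspace_events] yields a measurable type [V] of subspaces, to which
    product measures and Tonelli apply. *)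
Definition subspace_gen : set (set {vspace 'rV[K]_d}) :=
  [set (fun W => hnorm2 conj re (oproj conj W u)) @^-1` B
  | B in [set B : set R | measurable B] & u in [set: 'rV[K]_d]].

Local Notation V := (g_sigma_algebraType subspace_gen).
Local Notation norm2 := (hnorm2 conj re).
Local Notation proj := (oproj conj).

Lemma subspace_eventsE (A : set {vspace 'rV[K]_d}) :
  subspace_events conj re d A = measurable (A : set V).
Proof. by []. Qed.

Lemma random_subspace_measurable dT (T : measurableType dT) (W : T -> V) :
  random_subspace conj re W <-> measurable_fun [set: T] W.
Proof.
split=> [mW _ A mA|mW A mA]; first by rewrite setTI; exact: mW.
by rewrite -[X in measurable X]setTI; exact: mW.
Qed.

Section Residual.
Context {dT : measure_display} {T : measurableType dT}.
Variables (Wn : nat -> T -> {vspace 'rV[K]_d}) (x x0 : 'rV[K]_d).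

Definition residual n w := x - kaczmarz conj Wn x x0 n w.

Lemma residualS n w :
  residual n.+1 w = residual n w - proj (Wn n w) (residual n w).
Proof.
by rewrite /residual /= (oprojB HS) -addrA opprD addrA.
Qed.

End Residual.

(** The hypothesis stops at [i < n] so that the lemma also applies when [T] carries only the
    sigma-algebra of the first [n] subspaces. *)
Lemma coord_measurable_residual dT (T : measurableType dT)
    (Wn : nat -> T -> {vspace 'rV[K]_d}) x x0 n :
  (forall i, (i < n)%N -> random_subspace conj re (Wn i)) ->
  coord_measurable re (residual Wn x x0 n).
Proof.
elim: n => [|n IH] mW; first exact: (coord_measurable_cst re (x - x0)).
have mr := IH (fun i ni => mW i (ltnW ni)).
have -> : residual Wn x x0 n.+1 =
    (fun w => residual Wn x x0 n w - proj (Wn n w) (residual Wn x x0 n w)).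
  by apply/funext => w; exact: residualS.
apply: (coord_measurableB HS) => //.
by apply: (coord_measurable_oproj HS) => //; exact: mW.
Qed.

(** * The past of the process and its independence from the next subspace *)

Section History.
Context {dT : measure_display} {T : measurableType dT}.
Variables (P : probability T R) (Wn : nat -> T -> {vspace 'rV[K]_d}).
Hypothesis mWn : forall n, random_subspace conj re (Wn n).

(* A pi-system generating the sigma-algebra of the past W_1, ..., W_n. *)
Definition cylinders n : set (set T) :=
  [set \bigcap_(i in [set i | i \in iota 0 n]) (Wn i @^-1` A i)
  | A in [set A | forall i, subspace_events conj re d (A i)]].

Lemma cylinders_measurable n : cylinders n `<=` measurable.
Proof.
move=> _ [A mA <-]; apply: bigcap_measurableType => // i _.
by apply: mWn; exact: mA.
Qed.

Lemma cylinders_setI n : setI_closed (cylinders n).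
Proof.
move=> _ _ [A mA <-] [B mB <-]; exists (fun i => A i `&` B i).
  move=> i; rewrite subspace_eventsE.
  by apply: measurableI; [exact: mA|exact: mB].
by rewrite -bigcapI.
Qed.

Lemma cylinders_setT n : cylinders n [set: T].
Proof.
exists (fun=> setT); first by move=> i; rewrite subspace_eventsE.
by rewrite bigcapT.
Qed.

Lemma cylinders_preimage n i A : (i < n)%N -> subspace_events conj re d A ->
  cylinders n (Wn i @^-1` A).
Proof.
move=> ni mA; exists (fun j => if j == i then A else setT).
  by move=> j; case: eqP => // _; rewrite subspace_eventsE.
apply/seteqP; split=> w /=.
  by move=> /(_ i) /=; rewrite eqxx mem_iota ni; apply.
by move=> Aw j _; case: eqP => [->|].
Qed.

Lemma random_subspace_history n i : (i < n)%N ->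
  random_subspace (T := g_sigma_algebraType (cylinders n)) conj re (Wn i).
Proof.
by move=> ni A mA; apply: sub_sigma_algebra; exact: cylinders_preimage.
Qed.

Hypothesis indep : mutually_independent conj re P Wn.

(** On cylinders this is mutual independence, used for the indices up to [n] and for those below
    [n]; the pi-system argument extends it to the whole past. *)
Lemma history_independent n A B : <<s cylinders n >> A ->
  subspace_events conj re d B ->
  (P (A `&` Wn n @^-1` B) = P A * P (Wn n @^-1` B))%E.
Proof.
move=> hA mB; apply: independent_pi_system hA.
- exact: cylinders_measurable.
- exact: cylinders_setI.
- exact: cylinders_setT.
- exact: mWn.
move=> _ [A' mA' <-].
(* One family of events that agrees with [A'] on the past and prescribes [B] at time [n]. *)
pose C i := if i == n then B else A' i.
have mC i : subspace_events conj re d (C i) by rewrite /C; case: eqP.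
have Cn i : i \in iota 0 n -> C i = A' i.
  by rewrite mem_iota add0n => /andP[_ ni]; rewrite /C ltn_eqF.
have := indep (S := n :: iota 0 n) _ mC.
rewrite /= mem_iota add0n ltnn andbF iota_uniq => /(_ isT).
rewrite big_cons {2}/C eqxx muleC.
rewrite -(indep (S := iota 0 n) (iota_uniq _ _) mC).
have -> : \bigcap_(i in [set i | i \in iota 0 n]) (Wn i @^-1` C i) =
    \bigcap_(i in [set i | i \in iota 0 n]) (Wn i @^-1` A' i).
  by apply: eq_bigcapr => i /= /Cn ->.
move=> <-; congr (P _); apply/seteqP; split=> w /=.
  move=> [Aw Bw] i; rewrite /= inE => /predU1P[->|iS].
    by rewrite /C eqxx.
  by rewrite Cn//; exact: Aw.
move=> Cw; split=> [i /= iS|].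
  by rewrite -(Cn _ iS); apply: Cw; rewrite /= inE iS orbT.
by have := Cw n; rewrite /C eqxx; apply; rewrite /= inE eqxx.
Qed.

End History.

(** * One projection step from a fixed residual *)

Lemma hnorm2_sub_oproj_le (W : {vspace 'rV[K]_d}) (u : 'rV[K]_d) :
  0 <= norm2 (u - proj W u) <= norm2 u.
Proof.
rewrite (hnorm2_ge0 HS)/= (pythagoras HS) lerBlDr lerDl.
exact: (hnorm2_ge0 HS).
Qed.

Lemma neg_log_ratio_oproj_ge0 (W : {vspace 'rV[K]_d}) (u : 'rV[K]_d) :
  (0 <= neg_log_ratio (norm2 (u - proj W u)) (norm2 u))%E.
Proof.
by have /andP[] := hnorm2_sub_oproj_le W u; exact: neg_log_ratio_ge0.
Qed.

(** The relative decrease of the norm depends only on the direction of [u]; [v] is [u]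
    normalized. *)
Lemma exists_unit (u : 'rV[K]_d) : norm2 u != 0 ->
  exists2 v, norm2 v = 1 &
  forall W : {vspace 'rV[K]_d},
    norm2 (u - proj W u) / norm2 u = 1 - norm2 (proj W v).
Proof.
move=> u0; have un : 0 <= norm2 u := hnorm2_ge0 HS u.
have E : (Num.sqrt (norm2 u))^-1 ^+ 2 = (norm2 u)^-1.
  by rewrite exprVn sqr_sqrtr.
exists (inj (Num.sqrt (norm2 u))^-1 *: u) => [|W].
  by rewrite (hnorm2Z HS) E mulVf.
rewrite (oprojZ HS) (hnorm2Z HS) E (pythagoras HS).
by rewrite mulrBl divff// [_^-1 * _]mulrC.
Qed.

Section LogBound.
Context {dT : measure_display} {T : measurableType dT}.
Variables (P : probability T R) (W : T -> {vspace 'rV[K]_d}).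

(** Normalizing [u] shows that the supremum runs over a nonempty set; over the empty set, as in
    dimension 0, it would be [-oo]. *)
Lemma alpha_log_ge0 (u : 'rV[K]_d) : norm2 u != 0 ->
  (0 <= alpha_log conj re P W)%E.
Proof.
move=> /exists_unit[v v1 _]; apply: le_trans (expeR_ge0 _) _.
by apply: ereal_sup_ubound; exists v.
Qed.

Lemma integral_neg_log_ratio_ge (u : 'rV[K]_d) :
  (- lne (alpha_log conj re P W) <=
   \int[P]_t neg_log_ratio (norm2 (u - proj (W t) u)) (norm2 u))%E.
Proof.
(* At [u = 0] the decrement is [+oo] by convention, so the bound holds for every value a residual
   can take. *)
have [u0|u0] := eqVneq (norm2 u) 0.
  have E t : neg_log_ratio (norm2 (u - proj (W t) u)) (norm2 u) = +oo%E.
    by rewrite u0 /neg_log_ratio mulr0 eqxx.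
  under eq_integral do rewrite E.
  by rewrite integral_cst// [X in (_ * X)%E]probability_setT mule1 leey.
have [v v1 vE] := exists_unit u0.
have up : 0 < norm2 u by rewrite lt_neqAle eq_sym u0 (hnorm2_ge0 HS).
have E t : neg_log_ratio (norm2 (u - proj (W t) u)) (norm2 u) =
    neg_log_ratio (1 - norm2 (proj (W t) v)) 1.
  by rewrite neg_log_ratio_div ?vE// (hnorm2_ge0 HS).
under eq_integral do rewrite E.
(* The decrement is nonnegative, so the sign moves inside the integral without any integrability;
   the integrand becomes the one in [alpha_log]. *)
rewrite leeNl -integral_ge0N; last first.
  by move=> t _; rewrite -E; exact: neg_log_ratio_oproj_ge0.
have -> : (\int[P]_t - neg_log_ratio (1 - norm2 (proj (W t) v)) 1)%E =
    (\int[P]_t elog (1 - norm2 (proj (W t) v)))%E.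
  by apply: eq_integral => t _; rewrite (elogE _ ltr01) ln1 add0e.
set I := (\int[P]_t elog _)%E.
have Ia : (expeR I <= alpha_log conj re P W)%E.
  by apply: ereal_sup_ubound; exists v.
rewrite -[X in (X <= _)%E]expeRK lee_lne// in_itv/= leey andbT ?expeR_ge0//.
exact: alpha_log_ge0 u0.
Qed.

End LogBound.

(** * The random iteration: expected decrement, induction and conclusion *)

Section Main.
Context {dT : measure_display} {T : measurableType dT}.
Context {dT' : measure_display} {T' : measurableType dT'}.
Variables (P : probability T R) (P' : probability T' R).
Variables (W : T' -> {vspace 'rV[K]_d}) (Wn : nat -> T -> {vspace 'rV[K]_d}).
Variables (x x0 : 'rV[K]_d).
Hypothesis mW : random_subspace conj re W.
Hypothesis mWn : forall n, random_subspace conj re (Wn n).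
Hypothesis indep : mutually_independent conj re P Wn.
Hypothesis ident : forall n A, subspace_events conj re d A ->
  P (Wn n @^-1` A) = P' (W @^-1` A).

Local Notation e := (residual Wn x x0).
Local Notation alpha := (alpha_log conj re P' W).

Lemma measurable_residual n : measurable_fun [set: T] (fun w => norm2 (e n w)).
Proof.
by apply: (measurable_hnorm2 HS); apply: coord_measurable_residual => i _.
Qed.

Lemma hnorm2_residual_le n w : norm2 (e n w) <= norm2 (x - x0).
Proof.
elim: n => // n; apply: le_trans.
by rewrite residualS; have /andP[] := hnorm2_sub_oproj_le (Wn n w) (e n w).
Qed.

(** The bound for a fixed vector holds at each value of the residual, and [Wn n] is independent of
    the past and has the law of [W]; hence the bound survives averaging. *)
Lemma integral_step_ge n :
  (- lne alpha <= \int[P]_w neg_log_ratio (norm2 (e n.+1 w)) (norm2 (e n w)))%E.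
Proof.
(* The first factor is [T] itself with the coarser sigma-algebra of the past, so that the identity
   plays the role of the random variable recording the past. *)
pose H := g_sigma_algebraType (cylinders Wn n).
pose Y : {mfun T' >-> V} :=
  mfun_Sub (mem_set ((random_subspace_measurable (W : T' -> V)).1 mW)).
pose F (z : H * V) : \bar R :=
  neg_log_ratio (norm2 (e n z.1 - proj z.2 (e n z.1))) (norm2 (e n z.1)).
have me : coord_measurable re (fun z : H * V => e n z.1).
  have mh : coord_measurable re (residual (T := H) Wn x x0 n).
    apply: coord_measurable_residual => i ni.
    exact: random_subspace_history.
  move=> j c; exact: measurableT_comp (mh j c) measurable_fst.
have mp : coord_measurable re (fun z : H * V => proj z.2 (e n z.1)).
  apply: (coord_measurable_oproj HS) => //.
  by apply/random_subspace_measurable; exact: measurable_snd.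
have mF : measurable_fun [set: H * V] F.
  apply: measurable_neg_log_ratio; apply: (measurable_hnorm2 HS) => //.
  exact: (coord_measurableB HS).
have F0 z : (0 <= F z)%E.
  exact: neg_log_ratio_oproj_ge0.
(* The past is a sub-sigma-algebra of that of [T]. *)
have mH : measurable_fun [set: T] (id : T -> H).
  move=> _ A hA; rewrite setTI.
  have : <<s cylinders Wn n >> `<=` (measurable : set (set T)).
    apply: smallest_sub; first exact: sigma_algebra_measurable.
    exact: cylinders_measurable.
  exact.
under eq_integral do rewrite residualS.
apply: (@integral_independent_ge _ _ _ T H V R P (distribution P' Y)
  id (Wn n) F) => //.
- exact/random_subspace_measurable.
- move=> A B hA hB; rewrite /= /distribution/= /pushforward.
  rewrite -[X in (_ * X)%E](ident n)//.
  exact: history_independent.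
- move=> w; rewrite ge0_integral_distribution//.
    exact: (integral_neg_log_ratio_ge P' W (e n w)).
  exact: measurableT_comp mF (pair1_measurable _).
Qed.

Lemma expeR_integral_residual n : norm2 (x - x0) != 0 ->
  (expeR (- \int[P]_w neg_log_ratio (norm2 (e n w)) (norm2 (x - x0)))
   <= alpha ^+ n)%E.
Proof.
move=> c0; have cp : 0 < norm2 (x - x0).
  by rewrite lt_neqAle eq_sym c0 (hnorm2_ge0 HS).
have nlr0 k w : (0 <= neg_log_ratio (norm2 (e k w)) (norm2 (x - x0)))%E.
  apply: neg_log_ratio_ge0; first exact: (hnorm2_ge0 HS).
  exact: hnorm2_residual_le.
have st k w : (0 <= neg_log_ratio (norm2 (e k.+1 w)) (norm2 (e k w)))%E.
  rewrite residualS; exact: neg_log_ratio_oproj_ge0.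
have a0 : (0 <= alpha)%E by exact: alpha_log_ge0 c0.
elim: n => [|n IH].
  under eq_integral do rewrite /residual/= neg_log_ratio_fin// subrr.
  by rewrite integral0 oppe0 expeR0.
(* The total decrement telescopes through the residual [e n]; the exponential then turns the sum
   into a product, one factor [alpha] per step. *)
have -> : (\int[P]_w neg_log_ratio (norm2 (e n.+1 w)) (norm2 (x - x0)) =
    \int[P]_w neg_log_ratio (norm2 (e n w)) (norm2 (x - x0)) +
    \int[P]_w neg_log_ratio (norm2 (e n.+1 w)) (norm2 (e n w)))%E.
  rewrite -ge0_integralD//; last 2 first.
  - by apply: measurable_neg_log_ratio => //; exact: measurable_residual.
  - by apply: measurable_neg_log_ratio; exact: measurable_residual.
  apply: eq_integral => w _; apply: neg_log_ratio_trans => //.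
    exact: (hnorm2_ge0 HS).
  rewrite residualS.
  by have /andP[] := hnorm2_sub_oproj_le (Wn n w) (e n w).
rewrite oppeD; last by apply: ge0_adde_def; rewrite inE; exact: integral_ge0.
rewrite expeRD expeS muleC; apply: lee_pmul; rewrite ?expeR_ge0//.
rewrite -[leRHS]lneK ?in_itv/= ?a0 ?leey// lee_expeR leeNl.
exact: integral_step_ge.
Qed.

Lemma kaczmarz_log_convergence n :
  (expeR (\int[P]_w elog (norm2 (x - kaczmarz conj Wn x x0 n w)))
   <= alpha ^+ n * (norm2 (x - x0))%:E)%E.
Proof.
(* Starting at the solution, all residuals vanish and both sides are 0. *)
have [c0|c0] := eqVneq (norm2 (x - x0)) 0.
  have E w : elog (norm2 (x - kaczmarz conj Wn x x0 n w)) = -oo%E.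
    rewrite /elog ifT// eq_le (hnorm2_ge0 HS) andbT.
    by rewrite -[leRHS]c0; exact: hnorm2_residual_le.
  under eq_integral do rewrite E.
  rewrite integral_cst// [X in (_ * X)%E]probability_setT mule1.
  by rewrite c0 mule0.
have cp : 0 < norm2 (x - x0) by rewrite lt_neqAle eq_sym c0 (hnorm2_ge0 HS).
(* An inequality is enough here, and it covers the case of an infinite expected decrement. *)
have H : (\int[P]_w elog (norm2 (e n w)) <= (ln (norm2 (x - x0)))%:E -
    \int[P]_w neg_log_ratio (norm2 (e n w)) (norm2 (x - x0)))%E.
  under eq_integral do rewrite (elogE _ cp).
  apply: integral_cstB_le => [|w].
    by apply: measurable_neg_log_ratio => //; exact: measurable_residual.
  apply: neg_log_ratio_ge0; first exact: (hnorm2_ge0 HS).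
  exact: hnorm2_residual_le.
rewrite -lee_expeR in H; apply: (le_trans H).
rewrite expeRD /= lnK ?posrE// muleC lee_wpmul2r ?lee_fin ?(ltW cp)//.
exact: expeR_integral_residual.
Qed.

End Main.
End Kaczmarz.

(** * The real and complex cases *)

Lemma real_hilbert_scalars (R : realType) :
  hilbert_scalars (idfun : {rmorphism R -> R}) id idfun 0.
Proof.
split=> //=; first by move=> z; rewrite -expr2 sqr_ge0.
by move=> z; rewrite mul0r addr0.
Qed.

Lemma complex_hilbert_scalars (R : realType) :
  hilbert_scalars (@conjc R : {rmorphism R[i] -> R[i]}) (@Re R)
    (real_complex R : {rmorphism R -> R[i]}) (Complex 0 1).
Proof.
split.
- exact: conjcK.
- by move=> [a b] [a' b'].
- by move=> [a b].
- by move=> r [a b] /=; rewrite mul0r subr0.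
- by move=> r /=; rewrite oppr0.
- by move=> [a b]; apply/eqP; rewrite eq_complex /= eqxx; apply/eqP; ring.
- by move=> [a b] /=; rewrite mulrN opprK addr_ge0// -expr2 sqr_ge0.
(* The imaginary part of [z] is the real part of [z] multiplied by minus the imaginary unit. *)
- move=> z; rewrite {1}[z]complexE; congr (_ + _ * _%:C%C).
  by case: z => a b /=; rewrite oppr0 mul0r mulN1r sub0r opprK.
Qed.

(* H = R (conjugation = id, real part = id) and H = C = R[i] *)
Theorem theorem3p4 (R : realType) :
  thm34_statement (fun z : R => z) (fun z : R => z) /\
  thm34_statement (@conjc R) (@Re R).
Proof.
split=> d dT T P dT' T' P' W Wn x x0 mW mWn indep ident n.
- exact: (kaczmarz_log_convergence (real_hilbert_scalars R)).
- exact: (kaczmarz_log_convergence (complex_hilbert_scalars R)).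
Qed.
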